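(* Let $Z_1,\ldots,Z_{n+1}$ be i.i.d. from an arbitrary distribution $\mathcal P$, $V$ a data-dependent score function, $\alpha\in(0,1)$. Fix a finite grid $\mathcal G\subset[0,1]$ containing $0$ and $1$, and for $a\in\mathcal G$ let $S(a)=\frac{1}{n+1}\sum_{i=1}^{n+1}\mathbb 1\{V^{Z_{n+1}}_i\le Q(a;\hat{\mathcal F}^{Z_{n+1}}_i)\}$. Let $\tilde\alpha_1=\min\{a\in\mathcal G:S(a)\ge\alpha\}$, $\tilde\alpha_2=\max\{a\in\mathcal G:S(a)<\alpha\}$, $\alpha_1=S(\tilde\alpha_1)$, $\alpha_2=S(\tilde\alpha_2)$, and let $\tilde\alpha=\tilde\alpha_1$ with probability $\frac{\alpha-\alpha_2}{\alpha_1-\alpha_2}$ and $\tilde\alpha=\tilde\alpha_2$ with probability $\frac{\alpha_1-\alpha}{\alpha_1-\alpha_2}$, using randomization independent of the data. Then $\mathbb P\{V^{Z_{n+1}}_{n+1}\le Q(\tilde\alpha;\hat{\mathcal F}^{Z_{n+1}})\}=\alpha$.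
   Context: Data: $Z_i=(X_i,Y_i)\in\mathbb R^p\times\mathbb R$, $i=1,\ldots,n+1$; $X=\{X_1,\ldots,X_{n+1}\}$ (unordered). A localizer is a function $H(x_1,x_2,X)\in[0,1]$ of $x_1,x_2\in\mathbb R^p$ and of the unordered set $X$, satisfying $H(x,x,X)=1$ for all $x$; $H_{i,j}=H(X_i,X_j,X)$, $p^H_{i,j}=H_{i,j}/\sum_{k=1}^{n+1}H_{i,k}$. A data-dependent score function is a measurable map $V(z,\mathcal Z)\in[0,\infty)$, where $z\in\mathbb R^p\times\mathbb R$ and $\mathcal Z$ is an unordered multiset of $n+1$ points. $V^{Z_{n+1}}_i=V(Z_i,\{Z_1,\ldots,Z_{n+1}\})$, $i=1,\ldots,n+1$; $\hat{\mathcal F}^{Z_{n+1}}_i=\sum_{j=1}^{n+1}p^H_{i,j}\delta_{V^{Z_{n+1}}_j}$ and $\hat{\mathcal F}^{Z_{n+1}}=\sum_{j=1}^np^H_{n+1,j}\delta_{V^{Z_{n+1}}_j}+p^H_{n+1,n+1}\delta_\infty$; $\delta_v$ is the point mass at $v$. For a probability distribution $\mathcal F$ on $\mathbb R\cup\{\infty\}$ and $a\in[0,1]$, $Q(a;\mathcal F)=\inf\{t:\mathbb P_{T\sim\mathcal F}(T\le t)\ge a\}$ (with $Q(0;\mathcal F)=-\infty$). *)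

(* Defs.v *)
From HB Require Import structures.
From mathcomp Require Import all_boot all_order all_algebra.
From mathcomp Require Import all_classical all_reals all_analysis.
Set Implicit Arguments. Unset Strict Implicit. Unset Printing Implicit Defensive.
Import Order.TTheory GRing.Theory Num.Theory.
Local Open Scope classical_set_scope.
Local Open Scope ring_scope.

Section conformal_defs.
Context {R : realType}.

Definition feat (p : nat) := p.-tuple R.
Definition obs (p : nat) := (p.-tuple R * R)%type.

(* A finitely supported distribution sum_j w_j delta_{v_j} on R u {+oo}:
   its cdf P(T <= t) for real t. *)
Definition dcdf (m : nat) (w : 'I_m -> R) (v : 'I_m -> \bar R) (t : R) : R :=
  \sum_(j < m) (if (v j <= t%:E)%E then w j else 0).

(* Q(a; F) = inf { t : P_{T ~ F}(T <= t) >= a }  (so Q(0;F) = -oo). *)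
Definition quant (m : nat) (a : R) (w : 'I_m -> R) (v : 'I_m -> \bar R) : \bar R :=
  ereal_inf (EFin @` [set t : R | a <= dcdf w v t]).

Variables (n p : nat).
(* localizer H(x1, x2, X), X = the (unordered) multiset of n+1 features *)
Variable H : feat p -> feat p -> (n.+1).-tuple (feat p) -> R.
(* data-dependent score V(z, Z), Z = the (unordered) multiset of n+1 points *)
Variable V : obs p -> (n.+1).-tuple (obs p) -> R.
Variable zs : (n.+1).-tuple (obs p).

Definition features : (n.+1).-tuple (feat p) := map_tuple fst zs.
Definition Hmat (i j : 'I_n.+1) : R := H (tnth zs i).1 (tnth zs j).1 features.
Definition pH (i j : 'I_n.+1) : R := Hmat i j / \sum_(k < n.+1) Hmat i k.
Definition Vsc (i : 'I_n.+1) : R := V (tnth zs i) zs.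

(* \hat F_i = sum_j p^H_{i,j} delta_{V_j} *)
Definition Fhat_val (j : 'I_n.+1) : \bar R := (Vsc j)%:E.
(* \hat F = sum_{j <= n} p^H_{n+1,j} delta_{V_j} + p^H_{n+1,n+1} delta_oo *)
Definition Ftest_val (j : 'I_n.+1) : \bar R :=
  if j == ord_max then +oo%E else (Vsc j)%:E.

Definition Sfun (a : R) : R :=
  (n.+1)%:R^-1 *
  \sum_(i < n.+1) (if ((Vsc i)%:E <= quant a (pH i) Fhat_val)%E then 1 else 0).

Variables (G : seq R) (alpha : R).
(* tilde alpha_1 = min {a in G : S(a) >= alpha},
   tilde alpha_2 = max {a in G : S(a) < alpha}   (0, 1 in G) *)
Definition at1 : R := \big[Order.min/1]_(a <- G | alpha <= Sfun a) a.
Definition at2 : R := \big[Order.max/0]_(a <- G | Sfun a < alpha) a.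
Definition al1 : R := Sfun at1.
Definition al2 : R := Sfun at2.
(* randomized choice driven by u ~ Unif[0,1]: tilde alpha_1 with probability
   (alpha - alpha_2)/(alpha_1 - alpha_2), tilde alpha_2 otherwise *)
Definition atilde (u : R) : R :=
  if u < (alpha - al2) / (al1 - al2) then at1 else at2.

Definition covers (u : R) : Prop :=
  ((Vsc ord_max)%:E <= quant (atilde u) (pH ord_max) Ftest_val)%E.

End conformal_defs.

(* Main.v *)
(* Write L_i for the p^H_{i,.}-mass of the scores strictly below V_i. Since a
   weighted quantile is at least x iff the mass strictly below x is less than
   its level, V_i <= Q(a; F_i) iff L_i < a, and the same holds for the test
   distribution, because moving the atom at V_{n+1} to +oo does not change the
   mass strictly below V_{n+1}. The randomized level depends on the data only
   through the symmetric function S, so the events {L_i < atilde} have the same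
   probability for all i. Given the data, their average probability over U is
   r S(at1) + (1 - r) S(at2), which the choice of r makes equal to alpha.

   Measurability of L_i is read off the division-free form
   sum_{V_j < V_i} H_{i,j} < a * sum_k H_{i,k}. *)

Require Import Defs.
From HB Require Import structures.
From mathcomp Require Import all_boot all_order all_algebra perm.
From mathcomp Require Import all_classical all_reals all_analysis.
From mathcomp Require Import measurable_realfun.
From mathcomp Require Import ring.
Import Order.TTheory GRing.Theory Num.Theory.
Local Open Scope classical_set_scope.
Local Open Scope ring_scope.

Set Implicit Arguments.
Unset Strict Implicit.
Unset Printing Implicit Defensive.

(** * Laws of i.i.d. tuples *)

Section tuple_laws.
Context d (T : measurableType d) (n : nat).

Definition box (A : 'I_n -> set T) : set (n.-tuple T) :=
  \bigcap_(i in [set: 'I_n]) ((fun t => tnth t i) @^-1` A i).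

Lemma measurable_box (A : 'I_n -> set T) :
  (forall i, measurable (A i)) -> measurable (box A).
Proof.
move=> mA; apply: fin_bigcap_measurable => // i _.
by rewrite -[X in measurable X]setTI; exact: measurable_tnth.
Qed.

Definition boxes : set (set (n.-tuple T)) :=
  [set B | exists2 A, (forall i, measurable (A i)) & B = box A].

(** The coordinate preimages that generate the product sigma-algebra are boxes with all sides but
    one full. Boxes, unlike those preimages, are closed under intersection, as uniqueness of
    measures requires. *)
Lemma measurable_tuple_boxes :
  (measurable : set (set (n.-tuple T))) = <<s boxes >>.
Proof.
apply/seteqP; split; last first.
  apply: smallest_sub; first exact: sigma_algebra_measurable.
  by move=> _ [A mA ->]; exact: measurable_box.
apply: smallest_sub; first exact: smallest_sigma_algebra.
apply: (@big_ind _ (fun X => X `<=` <<s boxes >>)) => //.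
  by move=> X Y XG YG; rewrite subUset.
move=> i _ _ [B mB <-]; apply: sub_sigma_algebra.
exists (fun j => if j == i then B else setT) => [j|].
  by case: ifP.
rewrite setTI; apply/seteqP; split=> [t Bt j _|t /(_ i I)] /=.
  by case: eqP => // ->.
by rewrite eqxx.
Qed.

Lemma tuple_measure_unique (R : realType)
    (m1 m2 : {measure set (n.-tuple T) -> \bar R}) :
  (m1 setT < +oo)%E ->
  (forall A, (forall i, measurable (A i)) -> m1 (box A) = m2 (box A)) ->
  forall B, measurable B -> m1 B = m2 B.
Proof.
move=> m1oo m12 B mB.
apply: (measure_unique boxes (fun=> setT)) => //.
- exact: measurable_tuple_boxes.
- move=> _ _ [A mA ->] [A' mA' ->]; exists (fun i => A i `&` A' i).
    by move=> i; exact: measurableI.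
  by rewrite /box -bigcapI.
- move=> _; exists (fun=> setT) => //.
  by apply/seteqP; split.
- by apply/seteqP; split => // x _; exists 0%N.
- by move=> _ [A mA ->]; exact: m12.
Qed.

End tuple_laws.

(** * Exchangeability of i.i.d. data and averaging over positions *)

Section exchangeability.
Context d (T : measurableType d) d' (W : measurableType d').
Context dO (Omega : measurableType dO) (R : realType) (n : nat).
Variables (P : probability Omega R) (Pz : probability T R).
Variables (Q : probability W R).
Variables (Z : 'I_n.+1 -> Omega -> T) (U : Omega -> W).
Hypothesis Z_meas : forall i, measurable_fun setT (Z i).
Hypothesis U_meas : measurable_fun setT U.
Hypothesis iid_indep : forall (A : 'I_n.+1 -> set T) (B : set W),
  (forall i, measurable (A i)) -> measurable B ->
  P ((\bigcap_(i in [set: 'I_n.+1]) (Z i @^-1` A i)) `&` (U @^-1` B)) =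
  ((\prod_(i < n.+1) Pz (A i)) * Q B)%E.

Let Zt (w : Omega) : n.+1.-tuple T := [tuple Z i w | i < n.+1].

Let Zt_meas : measurable_fun setT Zt.
Proof.
apply/measurable_fun_tnthP => i.
rewrite (_ : _ \o _ = Z i) //.
by apply/funext => w; rewrite /= tnth_mktuple.
Qed.

Let preimage_box (A : 'I_n.+1 -> set T) :
  Zt @^-1` (box A) = \bigcap_(i in [set: 'I_n.+1]) (Z i @^-1` A i).
Proof.
by apply/seteqP; split=> w + i _ => /(_ i I) /=; rewrite /Zt tnth_mktuple.
Qed.

HB.instance Definition _ := isMeasurableFun.Build _ _ _ _ Zt Zt_meas.

Let mu := distribution P Zt.

Let mu_box (A : 'I_n.+1 -> set T) : (forall i, measurable (A i)) ->
  mu (box A) = (\prod_(i < n.+1) Pz (A i))%E.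
Proof.
move=> mA; rewrite /mu /distribution /pushforward preimage_box.
have := iid_indep mA measurableT.
by rewrite preimage_setT setIT probability_setT mule1.
Qed.

Let permute (s : 'S_n.+1) (zs : n.+1.-tuple T) :=
  [tuple tnth zs (s j) | j < n.+1].

Let permute_meas s : measurable_fun setT (permute s).
Proof.
apply/measurable_fun_tnthP => i.
rewrite (_ : _ \o _ = (fun t => tnth t (s i))); first exact: measurable_tnth.
by apply/funext => w; rewrite /= tnth_mktuple.
Qed.

HB.instance Definition _ s := isMeasurableFun.Build _ _ _ _ (permute s) (permute_meas s).

(** Permuting the coordinates only reorders the factors of the product that gives the mass of a
    box. *)
Let mu_permute s B : measurable B -> distribution mu (permute s) B = mu B.
Proof.
apply: tuple_measure_unique => [|A mA].
  by rewrite [X in (X < _)%E](@probability_setT _ _ _ (distribution mu (permute s))) ltry.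
rewrite [RHS]mu_box//.
have permute_box : permute s @^-1` (box A) = box (fun i => A ((s^-1)%g i)).
  apply/seteqP; split=> t At i _.
    by have := At ((s^-1)%g i) I; rewrite /permute /= tnth_mktuple permKV.
  by have := At (s i) I; rewrite /permute /= tnth_mktuple permK.
transitivity (mu (permute s @^-1` (box A))); first by [].
rewrite permute_box mu_box//.
by rewrite (reindex_inj (@perm_inj _ s)); apply: eq_bigr => i _; rewrite permK.
Qed.

Let joint (w : Omega) := (Zt w, U w).

Let joint_meas : measurable_fun setT joint.
Proof. exact: measurable_fun_pair. Qed.

HB.instance Definition _ := isMeasurableFun.Build _ _ _ _ joint joint_meas.

(** For fixed [B] both sides are finite measures in [A], and they agree on boxes by [iid_indep].
    This identifies the joint law with a product measure. *)
Let joint_rect A B : measurable A -> measurable B ->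
  distribution P joint (A `*` B) = (mu A * Q B)%E.
Proof.
move=> mA mB.
have mUB : measurable (U @^-1` B) by rewrite -[X in measurable X]setTI; exact: U_meas.
pose m1 := pushforward (mrestr P mUB) Zt.
pose m2 := mscale (NngNum (fine_ge0 (measure_ge0 Q B))) mu.
have m2E X : m2 X = (mu X * Q B)%E.
  by rewrite /m2 /mscale /= muleC fineK ?fin_num_measure.
rewrite -m2E; apply: (tuple_measure_unique (m1 := m1) (m2 := m2)) mA.
  rewrite /= /m1 /pushforward preimage_setT /mrestr setTI.
  by rewrite (le_lt_trans (probability_le1 P mUB)) ?ltry.
move=> A' mA'; rewrite [RHS]m2E mu_box// -iid_indep//.
by rewrite /= /m1 /pushforward /mrestr preimage_box.
Qed.

(** Integrating out [U] first turns each probability into an integral of [f i] over the data.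
    Exchangeability makes these n+1 integrals equal, and their sum is (n+1) [alpha]. *)
Lemma exchangeable_coverage (alpha : R) (c : 'I_n.+1 -> n.+1.-tuple T -> W -> bool) :
  (forall i, measurable_fun setT (fun x : n.+1.-tuple T * W => c i x.1 x.2)) ->
  (forall (s : 'S_n.+1) zs i u,
     c i [tuple tnth zs (s j) | j < n.+1] u = c (s i) zs u) ->
  (forall zs, (\sum_(i < n.+1) Q [set u | c i zs u] = ((n.+1)%:R * alpha)%:E)%E) ->
  P [set w | c ord_max [tuple Z i w | i < n.+1] (U w)] = alpha%:E.
Proof.
move=> mc cJ sumc.
pose C i := [set x : n.+1.-tuple T * W | c i x.1 x.2].
have mC i : measurable (C i).
  by rewrite -[X in measurable X]setTI; exact: (mc i measurableT [set true]).
pose f i zs := Q [set u | c i zs u].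
have fE i zs : f i zs = (Q \o xsection (C i)) zs.
  by rewrite /f/=; congr (Q _); apply/seteqP; split=> u; rewrite /xsection/= inE.
have mf i : measurable_fun setT (f i).
  apply: (eq_measurable_fun (Q \o xsection (C i))) => [zs _|].
    by rewrite fE.
  exact: measurable_fun_xsection.
have f_perm i : (\int[mu]_zs f i zs = \int[mu]_zs f ord_max zs)%E.
  (* The transposition brings point i to the last position, so by [cJ] the last event of the
     permuted data is event i of the original data. *)
  transitivity (\int[distribution mu (permute (tperm i ord_max))]_zs f ord_max zs)%E.
    rewrite ge0_integral_distribution//.
    apply: eq_integral => zs _ /=; rewrite /f; congr (Q _).
    by apply/seteqP; split=> u /=; rewrite cJ tpermR.
  by apply: eq_measure_integral => A mA _; exact: mu_permute.
have PE : P [set w | c ord_max [tuple Z i w | i < n.+1] (U w)]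
        = (\int[mu]_zs f ord_max zs)%E.
  transitivity (distribution P joint (C ord_max)); first by [].
  rewrite -(product_measure_unique joint_rect)//.
  by apply: eq_integral => zs _; rewrite fE.
have : (\sum_(i < n.+1) \int[mu]_zs f i zs = ((n.+1)%:R * alpha)%:E)%E.
  rewrite -ge0_integral_sum//.
  under eq_integral do rewrite sumc.
  by rewrite integral_cst// [X in (_ * X)%E](@probability_setT _ _ _ (distribution P Zt)) mule1.
rewrite (eq_bigr _ (fun i _ => f_perm i)) -PE.
set x := P _.
(* Finiteness permits cancelling the factor n+1 in the reals. *)
have : x \is a fin_num.
  rewrite /x fin_num_measure//.
  rewrite -[X in measurable X]setTI.
  exact: (joint_meas measurableT (mC ord_max)).
case: x => // x _; rewrite sumEFin sumr_const card_ord => -[] xE.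
by congr EFin; apply: (@mulfI _ (n.+1)%:R); rewrite ?pnatr_eq0// mulr_natl.
Qed.

End exchangeability.

(** * Coverage in terms of the mass below a score *)

Section quantile.
Context {R : realType}.

(** Finitely many values leave a gap just below [x]. The default [x - 1] covers the value -oo and
    the case where no value lies below [x]. *)
Lemma last_value_below m (v : 'I_m -> \bar R) (x : R) :
  exists2 t : R, t < x & forall j, (v j < x%:E)%E -> (v j <= t%:E)%E.
Proof.
pose r j := if v j is r%:E then r else x - 1.
exists (\big[Order.max/x - 1]_(j | (v j < x%:E)%E) r j).
  have xx : x - 1 < x by rewrite ltrBlDr ltrDl.
  apply: (@big_ind _ (fun t => t < x)) => // [a b|j].
    by rewrite gt_max => -> ->.
  by rewrite /r; case: (v j).
move=> j vj; have := @le_bigmax_cond _ _ _ (x - 1) j (fun j => v j < x%:E)%E r vj.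
move: vj; rewrite {1 2}/r; case: (v j) => [y| |] //= _ _.
by rewrite leNye.
Qed.

(** If the mass strictly below [x] reaches [a], some real t < x already collects it and bounds the
    quantile. Conversely, the cdf at any t < x is at most that mass, so no such t reaches [a]. *)
Lemma le_quant m (a x : R) (w : 'I_m -> R) (v : 'I_m -> \bar R) :
  (forall j, 0 <= w j) ->
  (x%:E <= quant a w v)%E = (\sum_(j < m | (v j < x%:E)%E) w j < a).
Proof.
move=> w0; apply/idP/idP => [xq|wa].
  rewrite ltNge; apply/negP => aw.
  have [t tx vt] := last_value_below v x.
  have : (quant a w v <= t%:E)%E.
    apply: ereal_inf_lbound; exists t => //=; apply: (le_trans aw).
    rewrite /dcdf -big_mkcond /= [leRHS](bigID (fun j => (v j < x%:E)%E)) /=.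
    rewrite [X in _ <= X + _](eq_bigl (fun j => (v j < x%:E)%E)).
      by rewrite lerDl sumr_ge0.
    by move=> j /=; case: (boolP (v j < _)%E) => [/vt ->|]; rewrite ?andbF.
  by move=> /(le_trans xq); rewrite lee_fin leNgt tx.
apply/ereal_infP => _ [t /= at_ <-]; rewrite lee_fin leNgt; apply/negP => tx.
move: (lt_le_trans wa at_); apply/negP; rewrite -leNgt /dcdf -big_mkcond /=.
rewrite [leRHS](bigID (fun j => (v j <= t%:E)%E)) /=.
rewrite [X in _ <= X + _](eq_bigl (fun j => (v j <= t%:E)%E)).
  by rewrite lerDl sumr_ge0.
move=> j /=; case: (boolP (v j <= _)%E) => [vt|]; rewrite ?andbF ?andbT//.
by rewrite (le_lt_trans vt)// lte_fin.
Qed.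

End quantile.

(** * Coverage events and the two grid levels *)

Section scores.
Context {R : realType} (n p : nat).
Local Notation T := (p.-tuple R * R)%type.
Variable H : p.-tuple R -> p.-tuple R -> (n.+1).-tuple (p.-tuple R) -> R.
Hypothesis H_range : forall x1 x2 X, 0 <= H x1 x2 X <= 1.
Hypothesis H_diag : forall x X, H x x X = 1.
Variable V : T -> (n.+1).-tuple T -> R.

Definition covered (i : 'I_n.+1) (zs : (n.+1).-tuple T) (a : R) : bool :=
  \sum_(j < n.+1 | Vsc V zs j < Vsc V zs i) Hmat H zs i j <
    a * \sum_(k < n.+1) Hmat H zs i k.

Lemma Hmat_ge0 zs i j : 0 <= Hmat H zs i j.
Proof. by have /andP[] := H_range (tnth zs i).1 (tnth zs j).1 (features zs). Qed.

Lemma sum_Hmat_gt0 zs i : 0 < \sum_(k < n.+1) Hmat H zs i k.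
Proof.
rewrite (bigD1 i)//= ltr_pwDl ?sumr_ge0// => [|j _]; last exact: Hmat_ge0.
by rewrite /Hmat H_diag.
Qed.

Lemma pH_ge0 zs i j : 0 <= pH H zs i j.
Proof. by rewrite divr_ge0 ?Hmat_ge0// ltW// sum_Hmat_gt0. Qed.

Lemma coveredE i zs a :
  covered i zs a = (\sum_(j < n.+1 | Vsc V zs j < Vsc V zs i) pH H zs i j < a).
Proof. by rewrite /pH -mulr_suml ltr_pdivrMr ?sum_Hmat_gt0. Qed.

Lemma le_quant_Fhat i zs a :
  ((Vsc V zs i)%:E <= quant a (pH H zs i) (Fhat_val V zs))%E = covered i zs a.
Proof.
rewrite le_quant => [|j]; last exact: pH_ge0.
by rewrite coveredE.
Qed.

Lemma le_quant_Ftest zs a :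
  ((Vsc V zs ord_max)%:E <= quant a (pH H zs ord_max) (Ftest_val V zs))%E
    = covered ord_max zs a.
Proof.
rewrite le_quant => [|j]; last exact: pH_ge0.
rewrite coveredE; congr (_ < _); apply: eq_bigl => j; rewrite /Ftest_val.
(* At the last index neither +oo nor the score itself lies strictly below the score. *)
by case: eqP => [->|_]; rewrite ?ltxx// lte_fin.
Qed.

Lemma covers_covered zs G alpha u :
  covers H V zs G alpha u <-> covered ord_max zs (atilde H V zs G alpha u).
Proof. by rewrite /covers le_quant_Ftest. Qed.

Lemma SfunE zs a :
  Sfun H V zs a = (n.+1)%:R^-1 * \sum_(i < n.+1) (if covered i zs a then 1 else 0).
Proof. by rewrite /Sfun; congr (_ * _); apply: eq_bigr => i _; rewrite le_quant_Fhat. Qed.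

(** This makes 0 an admissible default for the maximum in [at2]. *)
Lemma Sfun0 zs : Sfun H V zs 0 = 0.
Proof.
rewrite SfunE big1 ?mulr0// => i _; rewrite /covered mul0r ltNge sumr_ge0//= => j _.
exact: Hmat_ge0.
Qed.

(** The atom at V_i has weight [H_{i,i}] = 1 before normalization and is not strictly below itself,
    so L_i < 1. Hence 1 is an admissible default for the minimum in [at1]. *)
Lemma Sfun1 zs : Sfun H V zs 1 = 1.
Proof.
rewrite SfunE (eq_bigr (fun=> 1)) => [|i _].
  by rewrite sumr_const card_ord mulVf// pnatr_eq0.
rewrite /covered mul1r [ltRHS](bigID (fun j => Vsc V zs j < Vsc V zs i))/=.
rewrite ltrDl (bigD1 i) ?ltxx//= ltr_pwDl ?sumr_ge0// => [|j _]; last exact: Hmat_ge0.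
by rewrite /Hmat H_diag.
Qed.

Lemma alpha_le_al1 zs G alpha : alpha < 1 -> alpha <= al1 H V zs G alpha.
Proof.
move=> a1; rewrite /al1 /at1; apply: (@big_ind _ (fun a => alpha <= Sfun H V zs a)) => //.
  by rewrite Sfun1 ltW.
by move=> x y; rewrite minElt; case: ifP.
Qed.

Lemma al2_lt_alpha zs G alpha : 0 < alpha -> al2 H V zs G alpha < alpha.
Proof.
move=> a0; rewrite /al2 /at2; apply: (@big_ind _ (fun a => Sfun H V zs a < alpha)) => //.
  by rewrite Sfun0.
by move=> x y; rewrite maxElt; case: ifP.
Qed.

(** * Equivariance under permutations of the data *)

Section permutation.
Hypothesis H_unordered : forall x1 x2 (X X' : (n.+1).-tuple (p.-tuple R)),
  perm_eq X X' -> H x1 x2 X = H x1 x2 X'.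
Hypothesis V_unordered : forall z (Z Z' : (n.+1).-tuple T),
  perm_eq Z Z' -> V z Z = V z Z'.
Variables (s : 'S_n.+1) (zs : (n.+1).-tuple T).
Let zs' := [tuple tnth zs (s j) | j < n.+1].

Lemma Vsc_perm i : Vsc V zs' i = Vsc V zs (s i).
Proof.
rewrite /Vsc tnth_mktuple; apply: V_unordered.
by apply/tuple_permP; exists s.
Qed.

Lemma Hmat_perm i j : Hmat H zs' i j = Hmat H zs (s i) (s j).
Proof.
rewrite /Hmat !tnth_mktuple; apply: H_unordered; apply: perm_map.
by apply/tuple_permP; exists s.
Qed.

Lemma covered_perm i a : covered i zs' a = covered (s i) zs a.
Proof.
rewrite /covered [in RHS](reindex_inj (@perm_inj _ s)).
rewrite [X in _ = (_ < _ * X)](reindex_inj (@perm_inj _ s)).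
congr (_ < _ * _); last by apply: eq_bigr => k _; rewrite Hmat_perm.
by apply: eq_big => [k|k _]; rewrite ?Vsc_perm ?Hmat_perm.
Qed.

Lemma Sfun_perm : Sfun H V zs' = Sfun H V zs.
Proof.
apply/funext => a; rewrite !SfunE; congr (_ * _).
rewrite [RHS](reindex_inj (@perm_inj _ s)).
by apply: eq_bigr => i _; rewrite covered_perm.
Qed.

Lemma atilde_perm G alpha u : atilde H V zs' G alpha u = atilde H V zs G alpha u.
Proof. by rewrite /atilde /al1 /al2 /at1 /at2 Sfun_perm. Qed.

End permutation.

(** * Measurability in the data *)

Section measurability.
Hypothesis H_meas : measurable_fun setT
  (fun x : (p.-tuple R * p.-tuple R) * (n.+1).-tuple (p.-tuple R) =>
     H x.1.1 x.1.2 x.2).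
Hypothesis V_meas : measurable_fun setT
  (fun x : T * (n.+1).-tuple T => V x.1 x.2).

Lemma measurable_Vsc i : measurable_fun setT (fun zs => Vsc V zs i).
Proof.
apply: (measurableT_comp V_meas (g := fun zs => (tnth zs i, zs))).
by apply: measurable_fun_pair => //; exact: measurable_tnth.
Qed.

Lemma measurable_features :
  measurable_fun setT (fun zs : (n.+1).-tuple T => features zs).
Proof.
apply/measurable_fun_tnthP => i.
rewrite (_ : _ \o _ = fst \o (fun zs => tnth zs i)).
  by apply: measurableT_comp => //; exact: measurable_tnth.
by apply/funext => zs; rewrite /= tnth_map.
Qed.

Lemma measurable_Hmat i j : measurable_fun setT (fun zs => Hmat H zs i j).
Proof.
apply: (measurableT_comp H_meas
  (g := fun zs => (((tnth zs i).1, (tnth zs j).1), features zs))).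
apply: measurable_fun_pair; last exact: measurable_features.
by apply: measurable_fun_pair; (apply: measurableT_comp => //; exact: measurable_tnth).
Qed.

Context dX (X : measurableType dX) (zs : X -> (n.+1).-tuple T).
Hypothesis zs_meas : measurable_fun setT zs.

Lemma measurable_covered i (a : X -> R) : measurable_fun setT a ->
  measurable_fun setT (fun x => covered i (zs x) (a x)).
Proof.
move=> ma; apply: measurable_fun_ltr; last first.
  apply: measurable_funM => //; apply: measurable_sum => k.
  exact: measurableT_comp (measurable_Hmat i k) zs_meas.
under eq_fun do rewrite big_mkcond.
apply: measurable_sum => j; apply: measurable_fun_ifT => //.
  by apply: measurable_fun_ltr; exact: measurableT_comp (measurable_Vsc _) zs_meas.
exact: measurableT_comp (measurable_Hmat i j) zs_meas.
Qed.

(** The level may vary with the data, so that [al1] and [al2], which are S at data-dependent levels,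
    are included. *)
Lemma measurable_Sfun (a : X -> R) : measurable_fun setT a ->
  measurable_fun setT (fun x => Sfun H V (zs x) (a x)).
Proof.
move=> ma; under eq_fun do rewrite SfunE.
apply: measurable_funM => //; apply: measurable_sum => i.
by apply: measurable_fun_ifT => //; exact: measurable_covered.
Qed.

Variables (G : seq R) (alpha : R).

Lemma measurable_at1 : measurable_fun setT (fun x => at1 H V (zs x) G alpha).
Proof.
rewrite /at1; elim: G => [|a r IH].
  under eq_fun do rewrite big_nil.
  exact: measurable_cst.
under eq_fun do rewrite big_cons.
apply: measurable_fun_ifT => //; last exact: measurable_minr.
by apply: measurable_fun_ler => //; exact: measurable_Sfun.
Qed.

Lemma measurable_at2 : measurable_fun setT (fun x => at2 H V (zs x) G alpha).
Proof.
rewrite /at2; elim: G => [|a r IH].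
  under eq_fun do rewrite big_nil.
  exact: measurable_cst.
under eq_fun do rewrite big_cons.
apply: measurable_fun_ifT => //; last exact: measurable_maxr.
by apply: measurable_fun_ltr => //; exact: measurable_Sfun.
Qed.

Lemma measurable_atilde (u : X -> R) : 0 < alpha -> alpha < 1 ->
  measurable_fun setT u ->
  measurable_fun setT (fun x => atilde H V (zs x) G alpha (u x)).
Proof.
move=> a0 a1 mu; rewrite /atilde.
apply: measurable_fun_ifT; [|exact: measurable_at1|exact: measurable_at2].
have mal1 := measurable_Sfun measurable_at1.
have mal2 := measurable_Sfun measurable_at2.
(* The denominator [al1 - al2] is positive, so the comparison of [u] with the quotient is rewritten
   without division. *)
under eq_fun.
  move=> x; rewrite ltr_pdivlMr; first over.
  by rewrite subr_gt0 (lt_le_trans (al2_lt_alpha _ _ _)) ?alpha_le_al1.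
apply: measurable_fun_ltr; last exact: measurable_funB.
by apply: measurable_funM => //; exact: measurable_funB.
Qed.

End measurability.
End scores.

(** * Randomization *)

Lemma uniform_prob_lt (R : realType) (r : R) : 0 <= r <= 1 ->
  uniform_prob (@ltr01 R) [set u | u < r] = r%:E.
Proof.
move=> /andP[r0 r1]; rewrite /uniform_prob integral_uniform_pdf.
(* Since r <= 1, only the part of the event in [0, r[ meets the support [0, 1] of the density. *)
rewrite (_ : _ `&` _ = `[0, r[%classic); last first.
  apply/seteqP; split=> x /=; rewrite !in_itv/=; first by case=> -> /andP[->].
  by move=> /andP[-> xr]; rewrite xr (le_trans (ltW xr)).
rewrite (eq_integral (cst 1%:E)) => [|x].
  rewrite integral_cst//= mul1e lebesgue_measure_itv/= lte_fin.
  by case: ltP => [_|r_le0]; rewrite ?sube0//; congr EFin; apply: le_anti; rewrite r0.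
rewrite inE/= in_itv/= => /andP[x0 xr].
by rewrite /uniform_pdf x0 (le_trans (ltW xr) r1)/= subr0 invr1.
Qed.

(** With the data fixed, [b1] and [b2] stand for the coverage outcomes at the two candidate
    levels. *)
Lemma uniform_prob_if (R : realType) (r : R) (b1 b2 : bool) : 0 <= r <= 1 ->
  uniform_prob (@ltr01 R) [set u | if u < r then b1 else b2] =
  (r * b1%:R + (1 - r) * b2%:R)%:E.
Proof.
move=> r01; have ltE := uniform_prob_lt r01.
have mlt : measurable [set u : R | u < r].
  by rewrite -set_itvNyo; exact: measurable_itv.
case: b1 b2 => [] [].
- rewrite (_ : mkset _ = setT); last by apply/seteqP; split=> // u _ /=; case: ifP.
  by rewrite probability_setT; congr EFin; rewrite /=; ring.
- rewrite (_ : mkset _ = [set u | u < r]); last first.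
    by apply/seteqP; split=> u /=; case: ifP.
  by rewrite ltE; congr EFin; rewrite /=; ring.
- rewrite (_ : mkset _ = ~` [set u | u < r]); last first.
    by apply/seteqP; split=> u /=; case: ifP.
  by rewrite [LHS]probability_setC// [X in (1 - X)%E]ltE; congr EFin; rewrite /=; ring.
- rewrite (_ : mkset _ = set0); last by apply/seteqP; split=> u //=; case: ifP.
  by rewrite measure0; congr EFin; rewrite /=; ring.
Qed.

(** * Exact coverage at the randomized level *)

Theorem theorem4
  (R : realType) (n p : nat)
  (* the localizer H(x1, x2, X) *)
  (H : p.-tuple R -> p.-tuple R -> (n.+1).-tuple (p.-tuple R) -> R)
  (H_range : forall x1 x2 X, 0 <= H x1 x2 X <= 1)
  (H_diag : forall x X, H x x X = 1)
  (H_unordered : forall x1 x2 (X X' : (n.+1).-tuple (p.-tuple R)),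
      perm_eq X X' -> H x1 x2 X = H x1 x2 X')
  (H_meas : measurable_fun setT
      (fun x : (p.-tuple R * p.-tuple R) * (n.+1).-tuple (p.-tuple R) =>
         H x.1.1 x.1.2 x.2))
  (* the data-dependent score function V(z, Z) *)
  (V : (p.-tuple R * R) -> (n.+1).-tuple (p.-tuple R * R) -> R)
  (V_ge0 : forall z Z, 0 <= V z Z)
  (V_unordered : forall z (Z Z' : (n.+1).-tuple (p.-tuple R * R)),
      perm_eq Z Z' -> V z Z = V z Z')
  (V_meas : measurable_fun setT
      (fun x : (p.-tuple R * R) * (n.+1).-tuple (p.-tuple R * R) => V x.1 x.2))
  (* level alpha and grid *)
  (alpha : R) (alpha_gt0 : 0 < alpha) (alpha_lt1 : alpha < 1)
  (G : seq R) (G_unit : {in G, forall a, 0 <= a <= 1})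
  (G0 : 0 \in G) (G1 : 1 \in G)
  (* the probability space, the data Z_1..Z_{n+1} and the randomization U *)
  (d : measure_display) (Omega : measurableType d) (P : probability Omega R)
  (Pz : probability (p.-tuple R * R)%type R)
  (Z : 'I_n.+1 -> Omega -> p.-tuple R * R)
  (Z_meas : forall i, measurable_fun setT (Z i))
  (U : Omega -> R) (U_meas : measurable_fun setT U)
  (* Z_1, ..., Z_{n+1} i.i.d. with law Pz, U ~ Unif[0,1], all independent *)
  (iid_indep : forall (A : 'I_n.+1 -> set (p.-tuple R * R)) (B : set R),
      (forall i, measurable (A i)) -> measurable B ->
      P ((\bigcap_(i in [set: 'I_n.+1]) (Z i @^-1` A i)) `&` (U @^-1` B)) =
      ((\prod_(i < n.+1) Pz (A i)) * uniform_prob (@ltr01 R) B)%E) :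
  P [set w | covers H V [tuple Z i w | i < n.+1] G alpha (U w)] = alpha%:E.
Proof.
pose c (i : 'I_n.+1) zs u := covered H V i zs (atilde H V zs G alpha u).
rewrite (_ : mkset _ = [set w | c ord_max [tuple Z i w | i < n.+1] (U w)]); last first.
  by apply/seteqP; split=> w /= /covers_covered; exact.
have cover := @exchangeable_coverage _ _ _ _ _ _ _ _ P Pz
  (uniform_prob (@ltr01 R)) Z U Z_meas U_meas iid_indep alpha c.
apply: cover.
- move=> i; apply: measurable_covered => //; exact: measurable_atilde.
- by move=> s zs i u; rewrite /c atilde_perm// covered_perm.
(* It remains to average over positions with the data fixed and only the uniform variable random. *)
move=> zs.
set r := (alpha - al2 H V zs G alpha) / (al1 H V zs G alpha - al2 H V zs G alpha).
have le1 := alpha_le_al1 H_range H_diag V zs G alpha_lt1.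
have lt2 := al2_lt_alpha H_range H_diag V zs G alpha_gt0.
have d_gt0 : 0 < al1 H V zs G alpha - al2 H V zs G alpha.
  by rewrite subr_gt0 (lt_le_trans lt2).
have r01 : 0 <= r <= 1.
  by rewrite ler_pdivlMr// ler_pdivrMr// mul0r mul1r lerD2r subr_ge0 ltW.
have count a : \sum_(i < n.+1) (covered H V i zs a)%:R = (n.+1)%:R * Sfun H V zs a.
  rewrite SfunE// mulVKf ?pnatr_eq0//.
  by apply: eq_bigr => i _; case: covered.
have uE i : uniform_prob (@ltr01 R) [set u | c i zs u] =
    (r * (covered H V i zs (at1 H V zs G alpha))%:R +
     (1 - r) * (covered H V i zs (at2 H V zs G alpha))%:R)%:E.
  rewrite -uniform_prob_if//; congr (uniform_prob _ _).
  by apply/seteqP; split=> u /=; rewrite /c /atilde -/r; case: ifP.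
rewrite (eq_bigr _ (fun i _ => uE i)).
rewrite sumEFin big_split/= -!mulr_sumr !count -/(al1 H V zs G alpha) -/(al2 H V zs G alpha).
(* The weight [r] is the solution of r [al1] + (1 - r) [al2] = [alpha]. *)
congr EFin; rewrite /r; field.
by rewrite gt_eqF.
Qed.
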